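(* Let $Q=\mathbb{Z}_{q_1}\times\mathbb{Z}_{q_2}\times\cdots\times\mathbb{Z}_{q_n}$. If there exists a mixed Steiner system $\mathrm{MS}(t,k,Q)$, then for each $i$ with $0\le i\le t-1$ and each subset $X$ of $[n]=\{1,\ldots,n\}$ of size $n-i$, $$\sum_{\substack{Y\subseteq X\\ |Y|=t-i}}\ \prod_{j\in Y}(q_j-1)\equiv 0\pmod{\binom{k-i}{t-i}}.$$
   Context: For integers $q_1,\dots,q_n\ge 2$, $Q=\mathbb{Z}_{q_1}\times\cdots\times\mathbb{Z}_{q_n}$ is viewed as the set of words of length $n$ whose $i$-th letter lies in $\mathbb{Z}_{q_i}$. The weight of a word is its number of nonzero coordinates, and $d(\cdot,\cdot)$ is the Hamming distance. For integers $1\le t\le k\le n$, a mixed Steiner system $\mathrm{MS}(t,k,Q)$ is a set $\mathcal{C}$ of words of $Q$ of weight $k$ such that (i) for every word $x\in Q$ of weight $t$ there is exactly one $c\in\mathcal{C}$ with $d(x,c)=k-t$; and (ii) any two distinct elements of $\mathcal{C}$ are at Hamming distance at least $2(k-t)+1$. *)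

(* Defs.v *)
From HB Require Import structures.
From mathcomp Require Import all_boot all_order all_algebra.

Set Implicit Arguments.
Unset Strict Implicit.
Unset Printing Implicit Defensive.

(* Coordinates are numbered 0, ..., n-1.  'Z_m is the ring of integers modulo
   m only for m >= 2, so [word q] is the product of the Z_(q i) under the
   hypothesis that every q i is at least 2. *)
Definition word (n : nat) (q : 'I_n -> nat) : finType :=
  {dffun forall i : 'I_n, 'Z_(q i)}.

Definition weight (n : nat) (q : 'I_n -> nat) (x : word q) : nat :=
  #|[set i : 'I_n | x i != 0%R]|.

Definition hamming (n : nat) (q : 'I_n -> nat) (x y : word q) : nat :=
  #|[set i : 'I_n | x i != y i]|.

Definition mixed_Steiner_system (n : nat) (q : 'I_n -> nat) (t k : nat)
    (C : {set word q}) : Prop :=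
  [/\ forall c : word q, c \in C -> weight c = k,
      forall x : word q, weight x = t ->
        exists! c : word q, c \in C /\ hamming x c = k - t
    & forall c c' : word q, c \in C -> c' \in C -> c <> c' ->
        2 * (k - t) + 1 <= hamming c c'].

(* Main.v *)
Require Import Defs.
From HB Require Import structures.
From mathcomp Require Import all_boot all_order all_algebra.

Set Implicit Arguments.
Unset Strict Implicit.
Unset Printing Implicit Defensive.

(* Fix X of size n - i and let W be the set of words of weight t that are equal
   to 1 at all i coordinates outside X; sorting them by their support inside X
   shows that #|W| is the sum in the theorem.  For x of weight t and c of
   weight k, d(x, c) = k - t says exactly that c agrees with x on the support
   of x.  Hence every x in W is below exactly one codeword c, necessarily equal
   to 1 outside X, and each such c has 'C(k - i, t - i) words of W below it, one
   for each (t - i)-subset of the part of its support inside X. *)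

Definition wsupp (n : nat) (q : 'I_n -> nat) (x : word q) : {set 'I_n} :=
  [set j | x j != 0%R].

Definition below (n : nat) (q : 'I_n -> nat) (x c : word q) : bool :=
  [forall j in wsupp x, c j == x j].

(** The letter 1 serves as a fixed nonzero choice: being nonzero, it is passed on to every word
    above. *)
Definition one_outside (n : nat) (q : 'I_n -> nat) (X : {set 'I_n}) :
    {set word q} :=
  [set x : word q | [forall j in ~: X, x j == 1%R]].

Definition restr (n : nat) (q : 'I_n -> nat) (c : word q) (S : {set 'I_n}) :
    word q :=
  [ffun j : 'I_n => if j \in S then c j else 0%R : 'Z_(q j)].

Lemma belowP (n : nat) (q : 'I_n -> nat) (x c : word q) :
  reflect (forall j, x j != 0%R -> c j = x j) (below x c).
Proof.
apply: (iffP forall_inP) => xc j; first by move=> xj; apply/eqP/xc; rewrite inE.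
by rewrite inE => /xc ->.
Qed.

Lemma one_outsideP (n : nat) (q : 'I_n -> nat) (X : {set 'I_n}) (x : word q) :
  reflect (forall j, j \notin X -> x j = 1%R) (x \in one_outside q X).
Proof.
rewrite inE; apply: (iffP forall_inP) => x1 j.
  by move=> jX; apply/eqP/x1; rewrite inE.
by rewrite inE => /x1 ->.
Qed.

(** The words differ throughout [wsupp c :\: wsupp x], which has at least [k - t] elements since the
    supports share at most [t]. Distance [k - t] thus leaves no room for a disagreement on
    [wsupp x]. Conversely, agreement there puts [wsupp x] inside [wsupp c], and the bound is
    attained. *)
Lemma hamming_below (n : nat) (q : 'I_n -> nat) (x c : word q) (t k : nat) :
  t <= k -> weight x = t -> weight c = k ->
  (hamming x c == k - t) = below x c.
Proof.
move=> le_tk wx wc; rewrite /hamming; set D := [set _ | _].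
have sub : wsupp c :\: wsupp x \subset D.
  by apply/subsetP=> j; rewrite !inE negbK => /andP[/eqP-> ?]; rewrite eq_sym.
have cardI : #|wsupp c :&: wsupp x| <= t by rewrite -wx subset_leq_card ?subsetIr.
have cardD : #|wsupp c :&: wsupp x| + #|wsupp c :\: wsupp x| = k.
  by rewrite cardsID -wc.
apply/idP/belowP => [/eqP hD j xj | xc].
  have eqD : wsupp c :\: wsupp x = D.
    by apply/eqP; rewrite eqEcard sub hD leq_subLR -cardD leq_add2r.
  apply/eqP/negPn/negP => cj.
  have: j \in D by rewrite inE eq_sym.
  by rewrite -eqD !inE xj.
have -> : D = wsupp c :\: wsupp x.
  apply/eqP; rewrite eqEsubset sub andbT; apply/subsetP => j; rewrite !inE negbK.
  case: (eqVneq (x j) 0%R) => [-> | /xc->]; first by rewrite eq_sym.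
  by rewrite eqxx.
have /setIidPr sI : wsupp x \subset wsupp c.
  by apply/subsetP=> j; rewrite !inE => xj; rewrite xc.
by rewrite cardsD sI -wc -wx.
Qed.

Lemma wsupp_restr (n : nat) (q : 'I_n -> nat) (c : word q) (S : {set 'I_n}) :
  wsupp (restr c S) = S :&: wsupp c.
Proof. by apply/setP=> j; rewrite !inE ffunE; case: ifP; rewrite ?eqxx. Qed.

(** Words below a fixed [c] are thus determined by their supports, so counting them reduces to
    counting sets. *)
Lemma below_restr (n : nat) (q : 'I_n -> nat) (x c : word q) :
  below x c -> x = restr c (wsupp x).
Proof.
move/belowP=> xc; apply/ffunP=> j; rewrite ffunE inE.
by case: eqVneq => [// | /xc->].
Qed.

Lemma restr_below (n : nat) (q : 'I_n -> nat) (c : word q) (S : {set 'I_n}) :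
  below (restr c S) c.
Proof. by apply/belowP=> j; rewrite ffunE; case: ifP; rewrite ?eqxx. Qed.

Lemma wsupp_one_outside (n : nat) (q : 'I_n -> nat) (X : {set 'I_n})
    (x : word q) : x \in one_outside q X -> ~: X \subset wsupp x.
Proof.
move/one_outsideP=> x1; apply/subsetP=> j; rewrite !inE => /x1->.
exact: GRing.oner_neq0.
Qed.

Lemma weight_one_outside (n : nat) (q : 'I_n -> nat) (X : {set 'I_n})
    (x : word q) : x \in one_outside q X ->
  weight x = #|~: X| + #|wsupp x :&: X|.
Proof.
move=> /wsupp_one_outside /setIidPr sI.
by rewrite -[LHS](cardsID X) addnC setDE sI.
Qed.

Lemma card_nonzero_Zp (m : nat) : 1 < m -> #|predC1 (0%R : 'Z_m)| = m - 1.
Proof. by move=> lt1m; rewrite cardC1 card_ord Zp_cast // subn1. Qed.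

Lemma card_one_outside_wsupp (n : nat) (q : 'I_n -> nat) (X Y : {set 'I_n}) :
    (forall j, 1 < q j) -> Y \subset X ->
  #|[set x in one_outside q X | wsupp x :&: X == Y]| = \prod_(j in Y) (q j - 1).
Proof.
move=> hq sYX.
(* The conditions on [x] split by coordinate: one letter is allowed outside [X], the [q j - 1]
   nonzero letters on [Y], and only 0 on the rest of [X]. *)
pose F (j : 'I_n) : pred 'Z_(q j) :=
  if j \notin X then pred1 1%R
  else if j \in Y then predC1 0%R else pred1 0%R.
have notY j : j \notin X -> (j \in Y) = false.
  by apply: contraNF; apply: (subsetP sYX).
transitivity #|(family F : simpl_pred (word q))|.
  apply: eq_card => x; rewrite inE.
  apply/andP/familyP => [[/one_outsideP x1 /eqP xY] j|xF].
    rewrite /F -xY !inE; case: ifPn => [/x1-> | /negPn jX]; first by rewrite inE.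
    by rewrite jX andbT; case: ifPn; rewrite ?negbK inE.
  split.
    by apply/one_outsideP => j jX; have:= xF j; rewrite /F jX inE => /eqP.
  apply/eqP/setP=> j; rewrite !inE; have:= xF j; rewrite /F.
  case: (boolP (j \in X)) => /= jX; last first.
    by rewrite andbF notY.
  by rewrite andbT; case: ifP; rewrite inE ?negbK => // _ /eqP->; rewrite eqxx.
rewrite card_family foldrE big_image /=.
rewrite [RHS]big_mkcond; apply: eq_bigr => j _; rewrite /F.
case: (boolP (j \in X)) => /= jX; last first.
  by rewrite card1 notY.
by case: ifP; rewrite ?card1 // card_nonzero_Zp.
Qed.

Lemma card_one_outside_weight (n t i : nat) (q : 'I_n -> nat) (X : {set 'I_n}) :
    (forall j, 1 < q j) -> i <= t -> #|~: X| = i ->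
  #|[set x in one_outside q X | weight x == t]| =
  \sum_(Y : {set 'I_n} | (Y \subset X) && (#|Y| == t - i))
     \prod_(j in Y) (q j - 1).
Proof.
move=> hq le_it cX; rewrite -sum1_card.
have wE x : x \in one_outside q X -> (weight x == t) = (#|wsupp x :&: X| == t - i).
  by move/weight_one_outside->; rewrite cX -(eqn_add2l i (#|_|)) subnKC.
rewrite (partition_big (fun x => wsupp x :&: X)
  (fun Y : {set 'I_n} => (Y \subset X) && (#|Y| == t - i))) /=; last first.
  by move=> x; rewrite inE subsetIr => /andP[xX]; rewrite wE.
apply: eq_bigr => Y /andP[sYX cY].
rewrite -(card_one_outside_wsupp hq sYX) -sum1_card; apply: eq_bigl => x.
rewrite !inE; case: (_ :&: X =P Y) => [xY | _]; rewrite ?andbF ?andbT //.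
by apply: andb_idr => x1; rewrite wE ?xY // inE.
Qed.

(** The map [Y |-> restr c (~: X :|: Y)] is a bijection from the [(t - i)]-subsets of [B] onto these
    words, with inverse [x |-> wsupp x :&: X]. *)
Lemma card_below_one_outside (n t k i : nat) (q : 'I_n -> nat) (X : {set 'I_n})
    (c : word q) : i <= t -> #|~: X| = i -> c \in one_outside q X ->
    weight c = k ->
  #|[set x in [set x in one_outside q X | weight x == t] | below x c]| =
  'C(k - i, t - i).
Proof.
move=> le_it cX c1 wc; pose B := wsupp c :&: X.
have cB : #|B| = k - i by rewrite -wc (weight_one_outside c1) cX addKn.
have sXc := wsupp_one_outside c1.
have suppR (Y : {set 'I_n}) : Y \subset B -> wsupp (restr c (~: X :|: Y)) :&: X = Y.
  move=> /subsetP sYB; apply/setP=> j; rewrite wsupp_restr !inE.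
  apply/idP/idP => [/andP[/andP[/orP[/negPf->|//] _]] // | jY].
  by have := sYB j jY; rewrite jY !inE orbT.
have oneR (Y : {set 'I_n}) : restr c (~: X :|: Y) \in one_outside q X.
  apply/one_outsideP=> j jX; rewrite ffunE !inE jX.
  exact: (one_outsideP _ _ c1).
rewrite -cB -cards_draws -(card_in_imset (f := fun Y => restr c (~: X :|: Y)));
  last first.
  apply: (can_in_inj (g := fun x => wsupp x :&: X)) => Y.
  by rewrite inE => /andP[/suppR].
apply: eq_card => x; rewrite inE [x \in [set _ in _ | _]]inE.
apply/andP/imsetP => [[/andP[xX /eqP wx] xc] | [Y]].
  have wE := weight_one_outside xX; exists (wsupp x :&: X).
    rewrite inE -wx wE cX addKn eqxx andbT setSI //.
    by rewrite (below_restr xc) wsupp_restr subsetIr.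
  (* Since [~: X] lies in the support of [x], that support equals [~: X :|: (wsupp x :&: X)]. *)
  rewrite {1}(below_restr xc) setUIr (setUC _ X) setUCr setIT.
  by rewrite (setUidPr (wsupp_one_outside xX)).
rewrite inE => /andP[sYB /eqP cY] ->; split; last exact: restr_below.
by rewrite oneR (weight_one_outside (oneR Y)) suppR // cX cY subnKC /=.
Qed.

Theorem corollary1 (n t k : nat) (q : 'I_n -> nat)
    (hq : forall j : 'I_n, 2 <= q j)
    (ht : 1 <= t) (htk : t <= k) (hkn : k <= n)
    (hMS : exists C : {set word q}, mixed_Steiner_system t k C)
    (i : nat) (hi : i <= t - 1) (X : {set 'I_n}) (hX : #|X| = n - i) :
  \sum_(Y : {set 'I_n} | (Y \subset X) && (#|Y| == t - i))
     \prod_(j in Y) (q j - 1) = 0 %[mod 'C(k - i, t - i)].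
Proof.
have [C [wC coverC _]] := hMS.
have le_it : i <= t by apply: leq_trans hi (leq_subr _ _).
have cX : #|~: X| = i.
  (* The truncated difference [n - (n - i)] is [i] because [i <= t <= k <= n]. *)
  by rewrite cardsCs setCK card_ord hX subKn // (leq_trans le_it) // (leq_trans htk).
rewrite -(card_one_outside_weight hq le_it cX) mod0n; apply/eqP.
set W := [set _ in _ | _].
have unique_cover x : x \in W -> \sum_(c in C | below x c) 1 = 1.
  rewrite inE => /andP[_ /eqP wx]; have [c [[cC hc] uc]] := coverC x wx.
  have hb c' : c' \in C -> (hamming x c' == k - t) = below x c'.
    by move/wC; apply: hamming_below.
  rewrite (big_pred1 c) // => c'; apply/andP/eqP => [[c'C]|->].
    by rewrite -hb // => /eqP hc'; rewrite (uc c').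
  by rewrite -hb // hc.
(* Double counting of the pairs [x] in [W], [c] in [C] with [x] below [c]: after the exchange,
   divisibility is checked for each codeword separately. *)
rewrite -[#|W|]sum1_card -(eq_bigr _ unique_cover) /=.
rewrite (exchange_big_dep (mem C)) /=; last by move=> x c _ /andP[].
apply: dvdn_sum => c cC.
rewrite (eq_bigl (fun x => x \in [set x in W | below x c])); last first.
  by move=> x; rewrite [RHS]inE cC.
rewrite sum1_card.
case: (boolP (c \in one_outside q X)) => [c1 | c1].
  by rewrite (card_below_one_outside le_it cX c1 (wC c cC)).
(* A codeword above some [x] in [W] inherits its letters 1 outside [X], so this [c] contributes
   0. *)
suff -> : [set x in W | below x c] = set0 by rewrite cards0 dvdn0.
apply/setP=> x; rewrite inE in_set0; apply: contraNF c1.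
rewrite [x \in W]in_set => /andP[/andP[/one_outsideP x1 _] /belowP xc].
by apply/one_outsideP=> j jX; rewrite xc x1 // GRing.oner_neq0.
Qed.
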